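(* For every integer $p\ge 4$ with $p\equiv 0$ or $1 \pmod 4$, let $f(n,K_p)$ denote the smallest number of colors in an edge coloring of the complete graph $K_n$ in which every copy of $K_p$ intersects at least one of the color classes in an odd number of edges. Then \[ f(n,K_p)=O\!\left(n^{\frac{4(p-2)}{p(p-1)}}\right), \] where the implied constant may depend on $p$.
   Context: For a graph $H$, $f(n,H)$ is the minimum number $t$ such that there is an edge coloring of $K_n$ with $t$ colors in which no copy of $H$ has every color appearing an even number of times among its edges (equivalently, every copy of $H$ meets some color class in an odd number of edges). The condition $p\equiv 0,1\pmod 4$ is exactly the condition that $\binom{p}{2}$ is even. *)

(* Defs.v *)
From mathcomp Require Import all_boot boolp.

Set Implicit Arguments.
Unset Strict Implicit.
Unset Printing Implicit Defensive.

(* A simple graph on the finite vertex type V is given by its edge set, a set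
   of 2-element subsets of V. *)
Definition complete (V : finType) : {set {set V}} := [set e : {set V} | #|e| == 2].

Definition Kedge (n : nat) : finType := {e : {set 'I_n} | e \in complete 'I_n}.

Definition copy (V : finType) (H : {set {set V}}) (n : nat)
    (phi : {ffun V -> 'I_n}) : {set {set 'I_n}} :=
  [set phi @: (e : {set V}) | e in H].

Definition color_class (n t : nat) (c : {ffun Kedge n -> 'I_t}) (a : 'I_t) :
    {set {set 'I_n}} :=
  [set val e | e : Kedge n & c e == a].

Definition odd_coloring (V : finType) (H : {set {set V}}) (n t : nat)
    (c : {ffun Kedge n -> 'I_t}) : bool :=
  [forall phi : {ffun V -> 'I_n}, injectiveb phi ==>
     [exists a : 'I_t, odd #|copy H phi :&: color_class c a|]].

Definition odd_colorable (V : finType) (H : {set {set V}}) (n t : nat) : bool :=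
  [exists c : {ffun Kedge n -> 'I_t}, odd_coloring H c].

(* f(n, H); the value 0 is used when no number of colors works, which can
   happen only if H has no edge (see fmin_complete for H = K_p). *)
Definition fmin (n : nat) (V : finType) (H : {set {set V}}) : nat :=
  if pselect (exists t, odd_colorable H n t) is left h then ex_minn h else 0.

Lemma odd_colorable_complete (n p : nat) :
  1 < p -> exists t, odd_colorable (complete 'I_p) n t.
Proof.
move=> p_gt1; exists #|Kedge n|; apply/existsP.
exists [ffun e => enum_rank e]; apply/forallP => phi; apply/implyP.
move=> /injectiveP phi_inj.
pose e0 : {set 'I_p} := [set Ordinal (ltnW p_gt1); Ordinal p_gt1].
have e0P : e0 \in complete 'I_p by rewrite inE cards2.
have f0P : phi @: e0 \in complete 'I_n.
  by rewrite inE card_imset //; move: e0P; rewrite inE.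
pose f0 : Kedge n := Sub (phi @: e0) f0P.
apply/existsP; exists (enum_rank f0).
suff -> : copy (complete 'I_p) phi :&:
    color_class [ffun e => enum_rank e] (enum_rank f0) = [set phi @: e0].
  by rewrite cards1.
apply/setP => x; rewrite in_setI in_set1; apply/andP/eqP => [[_]|->].
  by case/imsetP => e; rewrite inE ffunE => /eqP /enum_rank_inj -> ->.
split; first exact: imset_f.
by apply/imsetP; exists f0; rewrite ?inE ?ffunE.
Qed.

Lemma fmin_complete (n p : nat) : 1 < p ->
  odd_colorable (complete 'I_p) n (fmin n (complete 'I_p)) /\
  forall t, odd_colorable (complete 'I_p) n t -> fmin n (complete 'I_p) <= t.
Proof.
move=> p_gt1; rewrite /fmin; case: pselect => [h|[]].
  by case: ex_minnP.
exact: odd_colorable_complete.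
Qed.

(* Main.v *)
Require Import Defs.
From mathcomp Require Import all_boot zify.

(* Color the edges of [K_n] at random with [t] colors and let [m = 'C(p, 2)]. A
   coloring of [K_p] with all classes even uses at most [m / 2] colors, so it
   has probability [O(t ^ (- m / 2))], while a [K_p] shares an edge with only
   [O(n ^ (p - 2))] others. The local lemma thus applies as soon as
   [t ^ (m / 2) >= K n ^ (p - 2)], i.e. [t >= K' n ^ (4 (p - 2) / (p (p - 1)))].
   Probabilities are replaced by cardinals, and independence by the bound
   [card_evenly] on colorings even on a clique among those satisfying a
   condition that ignores the edges of this clique. *)

Set Implicit Arguments.
Unset Strict Implicit.
Unset Printing Implicit Defensive.

(** * Elementary counting bounds *)

Lemma leq_card_bigcup (T I : finType) (P : pred I) (B : I -> {set T}) :
  #|\bigcup_(i | P i) B i| <= \sum_(i | P i) #|B i|.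
Proof.
elim/big_ind2: _ => [|X m Y n leX leY|//]; first by rewrite cards0.
exact: leq_trans (leq_card_setU _ _) (leq_add leX leY).
Qed.

Lemma leq_bin_exp n k : 'C(n, k) <= n ^ k.
Proof.
elim: n k => [|n IHn] [|k] //; rewrite binS [n.+1 ^ _]expnS mulSn addnC.
have le_exp j : n ^ j <= n.+1 ^ j by case: j => [|j] //; rewrite leq_exp2r.
apply: leq_add; first exact: leq_trans (IHn k) (le_exp k).
by apply: leq_trans (IHn k.+1) _; rewrite expnS leq_mul2l le_exp orbT.
Qed.

(** * The symmetric local lemma in counting form *)

Section LocalLemma.

Variables (Omega I : finType) (A : I -> {set Omega}).

Definition avoid (F : {set I}) : {set Omega} :=
  [set x | [forall i in F, x \notin A i]].

Lemma avoidP (F : {set I}) x :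
  reflect (forall i, i \in F -> x \notin A i) (x \in avoid F).
Proof. by rewrite inE; apply: (iffP forall_inP). Qed.

Lemma avoid0 : avoid set0 = setT.
Proof. by apply/setP => x; rewrite in_setT; apply/avoidP => i; rewrite inE. Qed.

Lemma avoidS (F G : {set I}) : F \subset G -> avoid G \subset avoid F.
Proof.
move=> /subsetP FG; apply/subsetP => x /avoidP xG; apply/avoidP => i iF.
exact/xG/FG.
Qed.

Lemma leq_avoidU (F G : {set I}) :
  #|avoid F| <= #|avoid (F :|: G)| + \sum_(i in G) #|A i :&: avoid F|.
Proof.
apply: leq_trans (_ : #|avoid (F :|: G) :|: \bigcup_(i in G) (A i :&: avoid F)|
  <= _); last first.
  apply: leq_trans (leq_card_setU _ _) _.
  by rewrite leq_add2l leq_card_bigcup.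
apply/subset_leq_card/subsetP => x xF; rewrite in_setU.
have [//|xnG] := boolP (x \in avoid (F :|: G)); apply/bigcupP.
have [i iG xi] : exists2 i, i \in F :|: G & x \in A i.
  by move: xnG; rewrite inE negb_forall_in => /exists_inP[i iG /negPn]; exists i.
have xni : i \notin F by apply: contraL xi => /(avoidP _ _ xF).
by exists i; rewrite ?in_setI ?xi //; move: iG; rewrite inE (negbTE xni).
Qed.

Variables (nb : rel I) (d : nat).
Hypothesis d_gt0 : 0 < d.
Hypothesis nb_le : forall i, #|[set j | nb i j]| <= d.
(** In probabilities: conditioned on avoiding any family of non-neighbours, [A i] has probability at
    most [1 / (4 d)]. *)
Hypothesis rare : forall (i : I) (F : {set I}),
  (forall j, j \in F -> ~~ nb i j) -> 4 * d * #|A i :&: avoid F| <= #|avoid F|.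

(** Induction on [#|F|], splitting [F] into neighbours [F1] of [i] and the rest [F2]. By induction
    and a union bound over at most [d] neighbours, avoiding [F1] as well keeps at least half of
    [avoid F2], so the ratio [1 / (4 d)] given by [rare] at most doubles. *)
Lemma avoid_rare (F : {set I}) (i : I) :
  2 * d * #|A i :&: avoid F| <= #|avoid F|.
Proof.
have [k] := ubnP #|F|; elim: k => // k IHk in F i *; rewrite ltnS => Fk.
pose F1 := [set j in F | nb i j]; pose F2 := [set j in F | ~~ nb i j].
have FE : F = F2 :|: F1.
  by apply/setP => j; rewrite !inE; case: (j \in F); case: (nb i j).
have rare2 : 4 * d * #|A i :&: avoid F2| <= #|avoid F2|.
  by apply: rare => j; rewrite inE => /andP[].
have half : #|avoid F2| <= 2 * #|avoid F|.
  have [F10|[j jF1]] := set_0Vmem F1.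
    by rewrite FE F10 setU0 mul2n -addnn leq_addr.
  have F2k : #|F2| < k.
    apply: leq_trans Fk; apply/proper_card/properP; split.
      by apply/subsetP => l; rewrite inE => /andP[].
    by exists j; move: jF1; rewrite !inE => /andP[-> ji] //; rewrite ji.
  have sum_le : 2 * \sum_(j in F1) #|A j :&: avoid F2| <= #|avoid F2|.
    rewrite -(leq_pmul2l d_gt0) mulnA [d * 2]mulnC big_distrr /=.
    apply: leq_trans (leq_sum _ (fun j _ => IHk _ j F2k)) _.
    rewrite sum_nat_const leq_mul2r; apply/orP; right.
    apply: leq_trans (nb_le i); apply/subset_leq_card/subsetP => l.
    by rewrite !inE => /andP[].
  have := leq_avoidU F2 F1; rewrite -FE => le2.
  have := leq_add (leq_mul (leqnn 2) le2) (leqnn #|avoid F2|).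
  by rewrite mulnDr; lia.
have leA : #|A i :&: avoid F| <= #|A i :&: avoid F2|.
  by apply/subset_leq_card/setIS/avoidS; rewrite FE subsetUl.
nia.
Qed.

(** Events are excluded one at a time; by [avoid_rare] each removes at most half of what is left. *)
Lemma local_lemma : 0 < #|Omega| -> exists x, forall i, x \notin A i.
Proof.
move=> Omega_gt0; suff avoid_gt0 (F : {set I}) : 0 < #|avoid F|.
  have /card_gt0P[x /avoidP xI] := avoid_gt0 setT.
  by exists x => i; apply: xI.
have [k] := ubnP #|F|; elim: k => // k IHk in F *; rewrite ltnS => Fk.
have [->|[i iF]] := set_0Vmem F; first by rewrite avoid0 cardsT.
have := leq_avoidU (F :\ i) [set i]; rewrite setUC setD1K // big_set1.
have := avoid_rare (F :\ i) i.
have := IHk (F :\ i); rewrite (cardsD1 i F) iF in Fk; move=> /(_ Fk).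
nia.
Qed.

End LocalLemma.

(** * Counting the colorings that are even on a set of edges *)

Section EvenColorings.

Variables (E C : finType).

Definition evenly (T : {set E}) (c : {ffun E -> C}) : bool :=
  [forall a, ~~ odd #|[set e in T | c e == a]|].

Lemma eq_evenly (T : {set E}) (c c' : {ffun E -> C}) :
  {in T, c =1 c'} -> evenly T c = evenly T c'.
Proof.
move=> cc'; apply: eq_forallb => a; congr (~~ odd #|pred_of_set _|).
by apply/setP => e; rewrite !inE; case: (boolP (e \in T)) => // /cc' ->.
Qed.

Definition moved (T : {set E}) (r : E -> E) : {set E} :=
  [set e in T | r e != e].

(* [r] sends each edge of [T] to a representative of its color class; as these
   classes have at least two elements, at most half of [T] is fixed. *)
Lemma evenly_retraction (T : {set E}) (c : {ffun E -> C}) (e0 : E) :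
  evenly T c -> exists r : {ffun E -> E},
    [/\ r \in pffun_on e0 T T, #|T| <= 2 * #|moved T r|,
        {in T, forall e, c (r e) = c e} & {in T, forall e, r (r e) = r e}].
Proof.
move=> /forallP even_c.
(* The [pick] depends on [e] only through [c e], so edges of the same color get the same
   representative. The value [e0] off [T] only serves membership in [pffun_on]. *)
pose r := [ffun e => if e \in T then
  odflt e [pick e' in T | c e' == c e] else e0] : {ffun E -> E}.
have rP e : e \in T -> r e \in T /\ c (r e) = c e.
  by move=> eT; rewrite ffunE eT; case: pickP => [e' /andP[? /eqP]//|_].
have req e e' : e \in T -> e' \in T -> c e = c e' -> r e = r e'.
  move=> eT e'T cee'; rewrite !ffunE eT e'T cee'.
  by case: pickP => // /(_ e'); rewrite e'T eqxx.
have rK : {in T, forall e, r (r e) = r e}.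
  by move=> e eT; have [rT cr] := rP _ eT; apply: req.
exists r; split => //; last by move=> e /rP[].
  apply/pffun_onP; split.
    by apply/subsetP => e; rewrite inE ffunE; case: ifP => //; rewrite eqxx.
  by move=> _ /imageP[e eT ->]; case: (rP e eT).
have TE : T = moved T r :|: [set e in T | r e == e].
  by apply/setP => e; rewrite !inE; case: (e \in T); case: (r e == e).
rewrite {1}TE; apply: leq_trans (leq_card_setU _ _) _.
rewrite mul2n -addnn leq_add2l.
(* Each fixed edge is the image of a moved one: by parity its class contains another edge, which [r]
   sends to it. *)
apply: leq_trans (leq_imset_card r _).
apply/subset_leq_card/subsetP => e; rewrite inE => /andP[eT /eqP re].
have := even_c (c e); rewrite (cardsD1 e) inE eT eqxx /= negbK => oddD.
have /card_gt0P[e'] : 0 < #|[set x in T | c x == c e] :\ e| by case: #|_| oddD.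
rewrite !inE => /and3P[e'e e'T /eqP ce'].
have re' : r e' = e by rewrite -[RHS]re; apply: req.
by apply/imsetP; exists e'; rewrite ?inE ?e'T ?re' 1?eq_sym.
Qed.

(* The values on [D] of a coloring in the left-hand set are determined by its
   values off [D], and overwriting them arbitrarily does not leave [X]. *)
Lemma card_retraction (X : {set {ffun E -> C}}) (D : {set E}) (r : E -> E) :
    {in D, forall e, r e \notin D} ->
    (forall c c' : {ffun E -> C},
       {in [predC D], c =1 c'} -> c \in X -> c' \in X) ->
  #|[set c in X | [forall e in D, c (r e) == c e]]| * #|C| ^ #|D| <= #|X|.
Proof.
move=> rD X_indep; set Y := [set c in X | _].
have [->|[c0 _]] := set_0Vmem Y; first by rewrite cards0.
have [->|[e0 _]] := set_0Vmem D.
  rewrite cards0 muln1 subset_leq_card //.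
  by apply/subsetP => c; rewrite inE => /andP[].
(* Colorings of [D] are encoded as functions with the arbitrary value [c0 e0] off [D]. *)
pose G := pffun_on (c0 e0) D (@predT C).
pose merge (u : {ffun E -> C} * {ffun E -> C}) : {ffun E -> C} :=
  [ffun e => if e \in D then u.2 e else u.1 e].
have <- : #|setX Y [set g in G]| = #|Y| * #|C| ^ #|D|.
  by rewrite cardsX [#|[set g in G]|]cardsE card_pffun_on.
rewrite -(card_in_imset (f := merge)) => [|[c g] [c' g']].
  apply/subset_leq_card/subsetP => _ /imsetP[[c g] + ->].
  rewrite !inE /= => /andP[/andP[cX _] _].
  apply: X_indep cX => e; rewrite inE /= => eD.
  by rewrite ffunE /= (negbTE eD).
rewrite !inE /= => /andP[/andP[_ /forall_inP cr] /pffun_onP[/subsetP gD _]].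
move=> /andP[/andP[_ /forall_inP cr'] /pffun_onP[/subsetP gD' _]] /ffunP eq_m.
have eq_c e : e \notin D -> c e = c' e.
  by move=> eD; have := eq_m e; rewrite !ffunE (negbTE eD).
congr (_, _); apply/ffunP => e; have [eD|eD] := boolP (e \in D).
- by rewrite -(eqP (cr e eD)) -(eqP (cr' e eD)) eq_c ?rD.
- exact: eq_c.
- by have := eq_m e; rewrite !ffunE eD.
have out (h : {ffun E -> C}) : (forall x, x \in (c0 e0).-support h -> x \in D) ->
    h e = c0 e0.
  by move=> hD; apply/eqP; apply: contraNT eD => he; apply: hD.
by rewrite !out.
Qed.

(** Union bound over the at most [#|T| ^ #|T|] retractions of [T]: each moves at least half of [T],
    and [card_retraction] gains a factor [#|C|] per moved edge. *)
Lemma card_evenly (X : {set {ffun E -> C}}) (T : {set E}) :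
    0 < #|C| ->
    (forall c c' : {ffun E -> C},
       {in [predC T], c =1 c'} -> c \in X -> c' \in X) ->
  #|[set c | evenly T c] :&: X| * #|C| ^ uphalf #|T| <= #|T| ^ #|T| * #|X|.
Proof.
move=> C_gt0 X_indep.
have [->|[e0 e0T]] := set_0Vmem T.
  by rewrite cards0 muln1 mul1n subset_leq_card // subsetIr.
pose Y (r : {ffun E -> E}) :=
  [set c in X | [forall e in moved T r, c (r e) == c e]].
pose Q : {set {ffun E -> E}} := [set r in pffun_on e0 T T |
  (#|T| <= 2 * #|moved T r|) && [forall e in T, r (r e) == r e]].
have sub : [set c | evenly T c] :&: X \subset \bigcup_(r in Q) Y r.
  apply/subsetP => c; rewrite !inE => /andP[/(evenly_retraction e0) + cX].
  case=> r [rT leT cr rr].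
  apply/bigcupP; exists r; rewrite in_set ?rT ?leT ?cX /=.
    by apply/forall_inP => e eT; rewrite rr.
  by apply/forall_inP => e; rewrite inE => /andP[eT _]; rewrite cr.
apply: leq_trans (leq_mul (subset_leq_card sub) (leqnn _)) _.
apply: leq_trans (leq_mul (leq_card_bigcup _ _) (leqnn _)) _.
rewrite big_distrl /= -(card_pffun_on e0 T T).
apply: leq_trans (_ : \sum_(r in Q) #|X| <= _); last first.
  rewrite sum_nat_const leq_mul2r; apply/orP; right.
  by apply/subset_leq_card/subsetP => r; rewrite inE => /andP[].
apply: leq_sum => r; rewrite inE => /and3P[_ leT /forall_inP rr].
apply: leq_trans (card_retraction (D := moved T r) (r := r) _ _).
- rewrite leq_mul2l leq_pexp2l ?orbT //.
  by rewrite uphalf_half; have := odd_double_half #|T|; lia.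
(* Idempotence makes [r e] a fixed edge. *)
- by move=> e; rewrite !inE => /andP[eT _]; rewrite rr // andbF.
move=> c c' cc'; apply: X_indep => e; rewrite inE /= => eT; apply: cc'.
by rewrite !inE (negbTE eT).
Qed.

End EvenColorings.

(** * Cliques of the complete graph and the bound on the number of colors *)

Section Cliques.

Variables (n t p : nat).

Definition clique (S : {set 'I_n}) : {set Kedge n} :=
  [set e : Kedge n | val e \subset S].

Lemma card_clique (S : {set 'I_n}) : #|clique S| = 'C(#|S|, 2).
Proof.
rewrite -cards_draws -(card_imset _ val_inj); congr #|pred_of_set _|.
apply/setP => e; apply/imsetP/idP => [[f]|].
  by rewrite !inE => fS ->; rewrite fS; have := valP f; rewrite inE.
rewrite inE => /andP[eS e2]; have eK : e \in complete 'I_n by rewrite inE.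
by exists (Sub e eK); rewrite ?inE.
Qed.

(** A copy of the complete graph consists of all edges inside the image of [phi], so only this
    vertex set matters. *)
Lemma odd_coloring_evenly (c : {ffun Kedge n -> 'I_t}) :
    (forall S : {set 'I_n}, #|S| = p -> ~~ evenly (clique S) c) ->
  odd_coloring (complete 'I_p) c.
Proof.
move=> c_odd; apply/forallP => phi; apply/implyP => /injectiveP phi_inj.
pose S := phi @: [set: 'I_p].
have /c_odd : #|S| = p by rewrite card_imset // cardsT card_ord.
rewrite negb_forall => /existsP[a /negPn odd_a]; apply/existsP; exists a.
rewrite -(card_imset _ val_inj) in odd_a.
suff -> : copy (complete 'I_p) phi :&: color_class c a =
  [set val e | e in [set e in clique S | c e == a]] by [].
apply/setP => f; rewrite in_setI; apply/andP/imsetP => [[]|[e + ->]].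
  case/imsetP => g _ -> /imsetP[e]; rewrite inE => cea fe.
  by exists e; rewrite // !inE cea -fe imsetS ?subsetT.
rewrite !inE => /andP[eS cea]; split; last first.
  by apply/imsetP; exists e; rewrite ?inE.
have eE : phi @: (phi @^-1: val e) = val e.
  apply/setP => x; apply/imsetP/idP => [[y + ->]|xe]; first by rewrite inE.
  have /imsetP[y _ xy] := subsetP eS x xe.
  by exists y; rewrite // inE -xy.
apply/imsetP; exists (phi @^-1: val e); last by rewrite eE.
by rewrite inE -(card_imset _ phi_inj) eE; have := valP e; rewrite inE.
Qed.

(** Choose a shared edge among the ['C(p, 2)] edges of [S], then the other [p - 2] vertices of
    [T]. *)
Lemma card_clique_meet (S : {set 'I_n}) : 1 < p -> #|S| = p ->
  #|[set T : {set 'I_n} | (#|T| == p) && (clique S :&: clique T != set0)]|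
    <= 'C(p, 2) * n ^ (p - 2).
Proof.
move=> p_gt1 Sp.
pose B (e : Kedge n) := [set T : {set 'I_n} | (#|T| == p) && (val e \subset T)].
apply: leq_trans (_ : #|\bigcup_(e in clique S) B e| <= _).
  apply/subset_leq_card/subsetP => T; rewrite inE => /andP[Tp /set0Pn[e]].
  by rewrite !inE => /andP[eS eT]; apply/bigcupP; exists e; rewrite !inE ?Tp.
apply: leq_trans (leq_card_bigcup _ _) _.
rewrite -Sp -card_clique -sum_nat_const; apply: leq_sum => e _; rewrite Sp.
rewrite -(card_in_imset (f := fun T => T :\: val e)) => [|T T']; last first.
  rewrite !inE => /andP[_ eT] /andP[_ eT'] eqD.
  by rewrite -(setID T (val e)) -(setID T' (val e)) eqD !(setIidPr _).
apply: leq_trans (leq_bin_exp _ _); rewrite -[n in 'C(n, _)]card_ord -cardsT.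
rewrite -cards_draws; apply/subset_leq_card/subsetP => _ /imsetP[T + ->].
rewrite !inE subsetT /= => /andP[/eqP Tp eT].
by rewrite cardsD Tp (setIidPr eT); have := valP e; rewrite inE => /eqP ->.
Qed.

Lemma odd_colorable_bound : 0 < n -> 1 < p -> 0 < t ->
    4 * ('C(p, 2) * n ^ (p - 2)) * 'C(p, 2) ^ 'C(p, 2) <= t ^ uphalf 'C(p, 2) ->
  odd_colorable (complete 'I_p) n t.
Proof.
move=> n_gt0 p_gt1 t_gt0; set m := 'C(p, 2); set d := m * _ => t_big.
have m_gt0 : 0 < m by rewrite bin_gt0.
(* Events are indexed by all vertex sets and are empty unless [#|S| = p]. *)
pose A (S : {set 'I_n}) : {set {ffun Kedge n -> 'I_t}} :=
  [set c | (#|S| == p) && evenly (clique S) c].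
pose nb (S T : {set 'I_n}) :=
  [&& #|S| == p, #|T| == p & clique S :&: clique T != set0].
have [|S|S F F_nb||c c_odd] := @local_lemma _ _ A nb d.
- by rewrite muln_gt0 m_gt0 expn_gt0 n_gt0.
- have [Sp|Sp] := eqVneq #|S| p; last first.
    rewrite (_ : [set _ | _] = set0) ?cards0 //.
    by apply/setP => T; rewrite !inE /nb (negbTE Sp).
  by rewrite -(eq_card (A := [set T : {set 'I_n} | (#|T| == p) &&
    (clique S :&: clique T != set0)])) ?card_clique_meet // => T;
    rewrite !inE /nb Sp eqxx.
- have [Sp|Sp] := eqVneq #|S| p; last first.
    rewrite (_ : A S = set0) ?set0I ?cards0 ?muln0 //.
    by apply/setP => c; rewrite !inE (negbTE Sp).
  have AE : A S = [set c | evenly (clique S) c].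
    by apply/setP => c; rewrite !inE Sp eqxx.
  have := @card_evenly _ 'I_t (avoid A F) (clique S).
  rewrite card_ord card_clique Sp -/m AE => /(_ t_gt0) count.
  rewrite -(@leq_pmul2r (t ^ uphalf m)) ?expn_gt0 ?t_gt0 //.
  rewrite -mulnA; apply: leq_trans (leq_mul (leqnn _) (count _)) _.
    (* The cliques in [F] share no edge with [S], so recoloring [clique S] does not affect them. *)
    move=> c c' cc' /avoidP cF; apply/avoidP => T TF.
    have := cF T TF; rewrite !inE; have [Tp|//] := eqVneq #|T| p.
    rewrite (@eq_evenly _ _ _ c c') // => e eT; apply: cc'; rewrite inE /=.
    apply: contra (F_nb T TF) => eS; rewrite /nb Sp Tp eqxx /=.
    by apply/set0Pn; exists e; rewrite inE eS.
  by rewrite mulnA mulnC leq_mul2l t_big orbT.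
- by rewrite card_ffun card_ord expn_gt0 t_gt0.
apply/existsP; exists c; apply: odd_coloring_evenly => S Sp.
by have := c_odd S; rewrite inE Sp eqxx.
Qed.

End Cliques.

(* Real exponents and the asymptotic bound *)
From mathcomp Require Import all_order all_algebra.
From mathcomp Require Import all_classical all_reals all_analysis.
From mathcomp Require Import ring lra.
Import Order.TTheory GRing.Theory Num.Theory.
Import numFieldNormedType.Exports.
Local Open Scope ring_scope.
Local Open Scope classical_set_scope.

(** Since [p (p - 1) = 2 'C(p, 2)], the exponent is [2 (p - 2) / 'C(p, 2)]. The square on the right
    avoids halving ['C(p, 2)]. *)
Lemma powR_clique_exponent (R : realType) (n p : nat) : (1 < p)%N ->
  ((n%:R : R) `^ ((4 * (p%:R - 2)) / (p%:R * (p%:R - 1)))) ^+ 'C(p, 2) =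
  (n%:R ^+ (p - 2)) ^+ 2.
Proof.
move=> p_gt1; rewrite -powR_mulrn ?powR_ge0 // -powRrM -exprM -powR_mulrn //.
congr (_ `^ _).
have binE : p%:R * (p%:R - 1) = 2 * 'C(p, 2)%:R :> R.
  have := mul_bin_diag p 1; rewrite bin1 => /(congr1 (GRing.natmul (1 : R))).
  by rewrite !natrM -subn1 natrB ?(ltnW p_gt1).
have m_neq0 : 'C(p, 2)%:R != 0 :> R by rewrite pnatr_eq0 -lt0n bin_gt0.
by rewrite binE natrM natrB //; field.
Qed.

Lemma fmin_le_powR (R : realType) (n p : nat) : (0 < n)%N -> (3 < p)%N ->
  (fmin n (complete 'I_p))%:R <= 2 * (4 * 'C(p, 2) ^ ('C(p, 2)).+1)%:R *
    (n%:R : R) `^ ((4 * (p%:R - 2)) / (p%:R * (p%:R - 1))).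
Proof.
move=> n_gt0 p_gt3; have p_gt1 : (1 < p)%N by apply: leq_trans p_gt3.
have := powR_clique_exponent R n p_gt1; set y := _ `^ _.
set m := 'C(p, 2); set K := (4 * _)%N => yE.
have m_gt1 : (1 < m)%N.
  by apply: leq_trans (leq_bin2l 2 p_gt3).
have K_gt0 : (0 < K)%N by rewrite muln_gt0 expn_gt0 (ltnW m_gt1).
have K_ge1 : 1 <= K%:R :> R by rewrite ler1n.
have y_ge1 : 1 <= y.
  rewrite -(powRr0 n%:R) ler_powR ?ler1n // divr_ge0 ?mulr_ge0 ?subr_ge0 //.
    by rewrite ler_nat.
  by rewrite ler1n ltnW.
have x_ge1 : 1 <= K%:R * y by rewrite mulr_ege1.
have /andP[tx xt] := truncn_itv (le_trans ler01 x_ge1).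
(* Rounding up gives [K y < t <= K y + 1 <= 2 K y], whence the factor 2 in the constant. *)
set t := (Num.truncn (K%:R * y)).+1 in xt.
apply: le_trans (_ : t%:R <= _); last by rewrite /t -natr1 -mulrA; lra.
have [_ fmin_le] := fmin_complete n p_gt1; rewrite ler_nat; apply: fmin_le.
apply: odd_colorable_bound => //; rewrite -/m.
have -> : (4 * (m * n ^ (p - 2)) * m ^ m = K * n ^ (p - 2))%N.
  by rewrite /K expnS; lia.
(* After squaring, the chain is [K^2 y^m <= (K y)^m <= t^m <= t^(2 uphalf m)], using [2 <= m] and
   [1 <= K]. *)
rewrite -(leq_exp2r _ _ (isT : (0 < 2)%N)) -(ler_nat R) expnMn natrM !natrX.
rewrite -yE.
apply: le_trans (_ : (K%:R * y) ^+ m <= _).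
  rewrite exprMn ler_wpM2r ?exprn_ge0 ?(le_trans ler01) //.
  exact: ler_weXn2l.
apply: le_trans (_ : t%:R ^+ m <= _).
  by rewrite lerXn2r ?nnegrE ?(ltW xt) // (le_trans ler01 x_ge1).
rewrite -exprM ler_weXn2l ?ler1n //.
by rewrite uphalf_half; have := odd_double_half m; lia.
Qed.

Theorem theorem1p2 (R : realType) (p : nat) (hp : (4 <= p)%N)
    (hp4 : (p %% 4 = 0)%N \/ (p %% 4 = 1)%N) :
  (fun n : nat => (fmin n (complete 'I_p))%:R : R^o) =O_\oo
  (fun n : nat =>
     n%:R `^ ((4 * (p%:R - 2)) / (p%:R * (p%:R - 1))) : R^o).
Proof.
apply/eqO_exP; exists (2 * (4 * 'C(p, 2) ^ ('C(p, 2)).+1)%:R).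
  by rewrite mulr_gt0 // ltr0n muln_gt0 expn_gt0 bin_gt0 (leq_trans _ hp).
near=> n; rewrite [`|_ `^ _|]ger0_norm ?powR_ge0 // ger0_norm //.
by apply: fmin_le_powR hp; near: n; exact: nbhs_infty_gt.
Unshelve. all: by end_near.
Qed.
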